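(* (1) The statement that the underlying type of $[\![b]\!]_{\Sigma_1}$ is compact for every Brouwer code $b:\mathrm B$ is (logically) equivalent to $\mathrm{LPO}$. (2) If the underlying type of $[\![b]\!]_{\Sigma^1}$ is discrete for every Brouwer code $b:\mathrm B$, then $\mathrm{WLPO}$ holds.
   Context: Foundation: intensional Martin-Löf type theory as in the HoTT Book, with $\mathbf 0$, $\mathbf 1$ (point $\star$), $\mathbf 2$ (points $0,1$), $\mathbb N$, $+$, $\Pi$, $\Sigma$, universes, univalence (hence function extensionality), propositional truncation and set quotients. No excluded middle is assumed. $f^{-1}(y):=\Sigma_x(f\,x=y)$; an embedding is a map all of whose fibers are propositions (types with at most one element). $X$ is decidable if $X+\neg X$, and discrete if its equality is decidable. $X$ is compact if for every $p:X\to\mathbf 2$ the type $\Sigma_{x:X}\,p\,x=0$ is decidable. $\mathrm{LPO}$: for every $p:\mathbb N\to\mathbf 2$ the type $\Sigma_n\,p\,n=0$ is decidable. $\mathrm{WLPO}$: for every $p:\mathbb N\to\mathbf 2$ the type $\prod_n\,p\,n=1$ is decidable. Ordinals. An ordinal is a type with a proposition-valued, transitive, extensional (elements with the same predecessors are equal), well-founded relation $<$; the same symbol denotes an ordinal and its underlying type. $\mathbf 1$ is an ordinal with the empty order. A topped ordinal is an ordinal with a specified point $t$ such that $\neg(t<y)$ for all $y$; $\mathrm{Ord}^\top$ is their type. For a topped ordinal $\tau$ and $\upsilon:\tau\to\mathrm{Ord}^\top$, $\Sigma_\tau\upsilon$ is the topped ordinal $\Sigma_{x:\tau}\upsilon\,x$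 with the lexicographic order: $(x,a)<(x',a')$ iff $x<x'$, or there is $r:x=x'$ such that the transport of $a$ along $r$ is below $a'$; its top is the pair of tops. The sum $\tau+\upsilon$ of topped ordinals is the lexicographic sum, over the two-point topped ordinal with underlying type $\mathbf 1+\mathbf 1$ and $\mathrm{inl}\,\star<\mathrm{inr}\,\star$, of the family with members $\tau,\upsilon$. The topped ordinal $\omega+\mathbf 1$ is $\mathbb N+\mathbf 1$ with the usual order on $\mathbb N$ and the added point as top, above all $\mathrm{inl}\,n$. Conaturals: $\mathbb N_\infty:=\Sigma_{u:\mathbf 2^{\mathbb N}}\prod_i u_{i+1}\le u_i$; $\underline n$ is $n$ ones followed by zeros; $\infty$ is constantly $1$; $\iota:\mathbb N\hookrightarrow\mathbb N_\infty$, $\iota\,n=\underline n$. It is a topped ordinal with top $\infty$ under $u<v:\equiv\Sigma_{n:\mathbb N}(u=\underline n)\times(v_n=1)$. Extension: for an embedding $j:X\hookrightarrow K$ and $\alpha:X\to\mathrm{Ord}^\top$, $(\alpha/j)\,k:=\prod_{(x,p):j^{-1}(k)}\alpha\,x$ with order $u<v:\equiv\Sigma_{p:j^{-1}(k)}\,u\,p<v\,p$ and top the function assigning tops. Brouwer codes: $\mathrm B$ is the inductive type with constructors $\mathsf Z:\mathrm B$, $\mathsf S:\mathrm B\to\mathrm B$, $\mathsf L:(\mathbb N\to\mathrm B)\to\mathrm B$. Interpretations $[\![-]\!]_{\Sigma_1},[\![-]\!]_{\Sigma^1}:\mathrm B\to\mathrm{Ord}^\top$: both send $\mathsf Z$ to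 $\mathbf 1$ and $\mathsf S\,b$ to (interpretation of $b$)$\,+\mathbf 1$, while $[\![\mathsf L\,b]\!]_{\Sigma_1}=\Sigma_{\omega+\mathbf 1}\big((n\mapsto[\![b\,n]\!]_{\Sigma_1})/\mathrm{inl}\big)$ with $\mathrm{inl}:\mathbb N\hookrightarrow\mathbb N+\mathbf 1$, and $[\![\mathsf L\,b]\!]_{\Sigma^1}=\Sigma_{\mathbb N_\infty}\big((n\mapsto[\![b\,n]\!]_{\Sigma^1})/\iota\big)$. *)

(* Defs.v *)
From Stdlib Require Import Bool Arith Lia Peano_dec Eqdep_dec CRelationClasses
  FunctionalExtensionality.

(** Everything is [Type]-valued: relations, accessibility, decidability and
    the two sides of an equivalence carry data, and disjunction is [+].
    The only axiom used is function extensionality.  The identity type is [eq];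
    it lives in [Prop] but eliminates into [Type], so it has the full J rule,
    and neither proof irrelevance nor UIP is assumed for it. *)

Definition is_prop (A : Type) : Type := forall x y : A, x = y.

Definition decidable (A : Type) : Type := (A + notT A)%type.

Definition discrete (X : Type) : Type := forall x y : X, decidable (x = y).

(** The points [0] and [1] of the two-point type are [false] and [true]. *)
Definition compact (X : Type) : Type :=
  forall p : X -> bool, decidable {x : X & p x = false}.

Definition LPO : Type :=
  forall p : nat -> bool, decidable {n : nat & p n = false}.

Definition WLPO : Type :=
  forall p : nat -> bool, decidable (forall n : nat, p n = true).

Definition fiber {X Y : Type} (f : X -> Y) (y : Y) : Type := {x : X & f x = y}.

Definition is_embedding {X Y : Type} (f : X -> Y) : Type :=
  forall y : Y, is_prop (fiber f y).

Definition transport {X : Type} (P : X -> Type) {x x' : X} (r : x = x')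
  (a : P x) : P x' := eq_rect x P a x' r.

(** Accessibility in [Type], for a [Type]-valued relation ([Stdlib]'s [Acc]
    only covers relations in [Prop]). *)
Inductive acc {X : Type} (R : X -> X -> Type) (x : X) : Type :=
  acc_intro : (forall y : X, R y x -> acc R y) -> acc R x.

Record ordinal : Type := Ordinal {
  carrier :> Type;
  olt : carrier -> carrier -> Type;
  olt_prop : forall x y, is_prop (olt x y);
  olt_trans : forall x y z, olt x y -> olt y z -> olt x z;
  olt_ext : forall x y, (forall z, olt z x -> olt z y) ->
                        (forall z, olt z y -> olt z x) -> x = y;
  olt_wf : forall x, acc olt x
}.

Arguments olt {_} _ _.

Record topped_ordinal : Type := ToppedOrdinal {
  tord :> ordinal;
  top : tord;
  top_max : forall y : tord, notT (olt top y)
}.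

Arguments top {_}.

Lemma set_of_reflexive {X : Type} (R : X -> X -> Type)
  (Rp : forall x y, is_prop (R x y)) (Rr : forall x, R x x)
  (Re : forall x y, R x y -> x = y) (x y : X) : is_prop (x = y).
Proof.
  assert (H : forall p : x = y,
    p = eq_trans (eq_sym (Re x x (Rr x))) (Re x y (transport (R x) p (Rr x)))).
  { intros p; destruct p; cbn.
    destruct (Re x x (Rr x)); reflexivity. }
  intros p q; rewrite (H p), (H q).
  f_equal; f_equal; apply Rp.
Qed.

Lemma is_prop_forall {X : Type} (P : X -> Type) :
  (forall x, is_prop (P x)) -> is_prop (forall x, P x).
Proof.
  intros H f g; apply functional_extensionality_dep; intros x; apply H.
Qed.

Lemma is_prop_sigma {X : Type} (P : X -> Type) :
  is_prop X -> (forall x, is_prop (P x)) -> is_prop {x : X & P x}.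
Proof.
  intros HX HP [x a] [y b].
  destruct (HX x y); f_equal; apply HP.
Qed.

Lemma is_prop_prod (A B : Type) : is_prop A -> is_prop B -> is_prop (A * B).
Proof. intros HA HB [a b] [c d]; f_equal; auto. Qed.

Lemma is_prop_False : is_prop False.
Proof. intros []. Qed.

Lemma bool_set (x y : bool) : is_prop (x = y).
Proof. intros p q; apply (UIP_dec bool_dec). Qed.

Lemma le_prop (a b : bool) : is_prop (Bool.le a b).
Proof.
  destruct a; cbn.
  - apply bool_set.
  - intros [] []; reflexivity.
Qed.

Lemma irrefl_of_wf {X : Type} (R : X -> X -> Type) (x : X) :
  acc R x -> notT (R x x).
Proof. intros H; induction H as [x _ IH]; intros h; exact (IH x h h). Qed.

Lemma olt_irrefl (X : ordinal) (x : X) : notT (olt x x).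
Proof. apply irrefl_of_wf, olt_wf. Qed.

Lemma ordinal_set (X : ordinal) (x y : X) : is_prop (x = y).
Proof.
  apply (set_of_reflexive (fun x y : X =>
    ((forall z, olt z x -> olt z y) * (forall z, olt z y -> olt z x))%type)).
  - intros a b; apply is_prop_prod;
      do 2 (apply is_prop_forall; intros ?); apply olt_prop.
  - intros a; split; auto.
  - intros a b [h k]; exact (olt_ext X a b h k).
Qed.

Lemma one_lt_ext (x y : unit) :
  (forall z : unit, False -> False) -> (forall z : unit, False -> False) ->
  x = y.
Proof. destruct x, y; reflexivity. Qed.

Lemma one_lt_wf (x : unit) : acc (fun _ _ : unit => False) x.
Proof. constructor; intros y []. Qed.

Definition one : topped_ordinal :=
  {| tord := {| carrier := unit;
                olt := fun _ _ => False;
                olt_prop := fun _ _ => is_prop_False;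
                olt_trans := fun _ _ _ h _ => h;
                olt_ext := one_lt_ext;
                olt_wf := one_lt_wf |};
     top := tt;
     top_max := fun _ h => h |}.

Definition two_lt (x y : unit + unit) : Type :=
  match x, y with
  | inl _, inr _ => True
  | _, _ => False
  end.

Lemma two_lt_prop (x y : unit + unit) : is_prop (two_lt x y).
Proof.
  destruct x, y; cbn; try exact is_prop_False.
  intros [] []; reflexivity.
Qed.

Lemma two_lt_trans (x y z : unit + unit) :
  two_lt x y -> two_lt y z -> two_lt x z.
Proof. destruct x, y, z; cbn; tauto. Qed.

Lemma two_lt_ext (x y : unit + unit) :
  (forall z, two_lt z x -> two_lt z y) ->
  (forall z, two_lt z y -> two_lt z x) -> x = y.
Proof.
  destruct x as [[]|[]], y as [[]|[]]; intros h k; try reflexivity; exfalso.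
  - exact (k (inl tt) I).
  - exact (h (inl tt) I).
Qed.

Lemma two_lt_wf (x : unit + unit) : acc two_lt x.
Proof.
  assert (Hl : forall u, acc two_lt (inl u)).
  { intros u; constructor; intros [|] []. }
  destruct x; [apply Hl|].
  constructor; intros [|] []; apply Hl.
Qed.

Lemma two_lt_top (x : unit + unit) : notT (two_lt (inr tt) x).
Proof. destruct x; intros []. Qed.

Definition two : topped_ordinal :=
  {| tord := {| carrier := (unit + unit)%type;
                olt := two_lt;
                olt_prop := two_lt_prop;
                olt_trans := two_lt_trans;
                olt_ext := two_lt_ext;
                olt_wf := two_lt_wf |};
     top := inr tt;
     top_max := two_lt_top |}.

Definition omega1_lt (x y : nat + unit) : Type :=
  match x, y with
  | inl m, inl n => m < n
  | inl _, inr _ => True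
  | inr _, _ => False
  end.

Lemma omega1_lt_prop (x y : nat + unit) : is_prop (omega1_lt x y).
Proof.
  destruct x as [m|], y as [n|]; cbn; try exact is_prop_False.
  - intros p q; apply le_unique.
  - intros [] []; reflexivity.
Qed.

Lemma omega1_lt_trans (x y z : nat + unit) :
  omega1_lt x y -> omega1_lt y z -> omega1_lt x z.
Proof. destruct x, y, z; cbn; try tauto; lia. Qed.

Lemma omega1_lt_ext (x y : nat + unit) :
  (forall z, omega1_lt z x -> omega1_lt z y) ->
  (forall z, omega1_lt z y -> omega1_lt z x) -> x = y.
Proof.
  destruct x as [m|[]], y as [n|[]]; intros h k; try reflexivity.
  - f_equal; destruct (lt_eq_lt_dec m n) as [[lt|e]|lt]; [|exact e|]; exfalso.
    + specialize (k (inl m) lt); cbn in k; lia.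
    + specialize (h (inl n) lt); cbn in h; lia.
  - exfalso; specialize (k (inl m) I); cbn in k; lia.
  - exfalso; specialize (h (inl n) I); cbn in h; lia.
Qed.

Lemma omega1_lt_wf (x : nat + unit) : acc omega1_lt x.
Proof.
  assert (Hn : forall n k, k < n -> acc omega1_lt (inl k)).
  { induction n as [|n IH]; intros k hk; [lia|].
    constructor; intros [m|] h; cbn in h; [apply IH; lia|destruct h]. }
  destruct x as [n|].
  - apply (Hn (S n)); lia.
  - constructor; intros [m|] []; apply (Hn (S m)); lia.
Qed.

Lemma omega1_lt_top (x : nat + unit) : notT (omega1_lt (inr tt) x).
Proof. destruct x; intros []. Qed.

Definition omega1 : topped_ordinal :=
  {| tord := {| carrier := (nat + unit)%type;
                olt := omega1_lt;
                olt_prop := omega1_lt_prop;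
                olt_trans := omega1_lt_trans;
                olt_ext := omega1_lt_ext;
                olt_wf := omega1_lt_wf |};
     top := inr tt;
     top_max := omega1_lt_top |}.

Definition sum_lt (T : topped_ordinal) (U : T -> topped_ordinal)
  (s s' : {x : T & U x}) : Type :=
  (olt (projT1 s) (projT1 s') +
   {r : projT1 s = projT1 s' &
      olt (transport (fun x : T => carrier (U x)) r (projT2 s))
          (projT2 s')})%type.

Lemma sum_lt_prop (T : topped_ordinal) (U : T -> topped_ordinal)
  (s s' : {x : T & U x}) : is_prop (sum_lt T U s s').
Proof.
  intros [h|h] [k|k].
  - f_equal; apply olt_prop.
  - exfalso; destruct k as [r _]; rewrite r in h; exact (olt_irrefl T _ h).
  - exfalso; destruct h as [r _]; rewrite r in k; exact (olt_irrefl T _ k).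
  - f_equal; apply is_prop_sigma.
    + apply ordinal_set.
    + intros r; apply olt_prop.
Qed.

Lemma sum_lt_trans (T : topped_ordinal) (U : T -> topped_ordinal)
  (s s' s'' : {x : T & U x}) :
  sum_lt T U s s' -> sum_lt T U s' s'' -> sum_lt T U s s''.
Proof.
  destruct s as [x a], s' as [x' a'], s'' as [x'' a'']; unfold sum_lt; cbn.
  intros [h|[r h]] [k|[r' k]].
  - left; exact (olt_trans T _ _ _ h k).
  - destruct r'; left; exact h.
  - destruct r; left; exact k.
  - destruct r, r'; right; exists eq_refl; exact (olt_trans (U x) _ _ _ h k).
Qed.

Lemma sum_lt_le (T : topped_ordinal) (U : T -> topped_ordinal)
  (x : T) (a : U x) (x' : T) (a' : U x') :
  (forall s, sum_lt T U s (existT _ x a) -> sum_lt T U s (existT _ x' a')) ->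
  forall y : T, olt y x -> olt y x'.
Proof.
  intros h y l.
  destruct (h (existT (fun x : T => carrier (U x)) y top) (inl l))
    as [k|[r k]]; cbn in *.
  - exact k.
  - destruct r; exfalso; exact (top_max (U y) _ k).
Qed.

Lemma sum_lt_le_fiber (T : topped_ordinal) (U : T -> topped_ordinal)
  (x : T) (a a' : U x) :
  (forall s, sum_lt T U s (existT _ x a) -> sum_lt T U s (existT _ x a')) ->
  forall c : U x, olt c a -> olt c a'.
Proof.
  intros h c l.
  destruct (h (existT (fun x : T => carrier (U x)) x c)
              (inr (existT _ eq_refl l))) as [k|[r k]]; cbn in *.
  - exfalso; exact (olt_irrefl T x k).
  - rewrite (ordinal_set T x x r eq_refl) in k; exact k.
Qed.

Lemma sum_lt_ext (T : topped_ordinal) (U : T -> topped_ordinal)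
  (s s' : {x : T & U x}) :
  (forall z, sum_lt T U z s -> sum_lt T U z s') ->
  (forall z, sum_lt T U z s' -> sum_lt T U z s) -> s = s'.
Proof.
  destruct s as [x a], s' as [x' a']; intros h k.
  assert (e : x = x').
  { apply (olt_ext T); eapply sum_lt_le; eassumption. }
  destruct e; f_equal.
  apply (olt_ext (U x)); apply sum_lt_le_fiber; assumption.
Qed.

Lemma sum_lt_wf (T : topped_ordinal) (U : T -> topped_ordinal)
  (s : {x : T & U x}) : acc (sum_lt T U) s.
Proof.
  destruct s as [x a].
  revert a; induction (olt_wf T x) as [x _ IHx]; intros a.
  induction (olt_wf (U x) a) as [a _ IHa].
  constructor; intros [y b] [h|[r h]]; cbn in *.
  - exact (IHx y h b).
  - destruct r; exact (IHa b h).
Qed.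

Lemma sum_lt_top (T : topped_ordinal) (U : T -> topped_ordinal)
  (s : {x : T & U x}) : notT (sum_lt T U (existT _ top top) s).
Proof.
  destruct s as [x a]; intros [h|[r h]]; cbn in *.
  - exact (top_max T _ h).
  - destruct r; exact (top_max (U top) _ h).
Qed.

Definition topped_sum (T : topped_ordinal) (U : T -> topped_ordinal) :
  topped_ordinal :=
  {| tord := {| carrier := {x : T & U x};
                olt := sum_lt T U;
                olt_prop := sum_lt_prop T U;
                olt_trans := sum_lt_trans T U;
                olt_ext := sum_lt_ext T U;
                olt_wf := sum_lt_wf T U |};
     top := existT _ top top;
     top_max := sum_lt_top T U |}.

Definition topped_plus (T U : topped_ordinal) : topped_ordinal :=
  topped_sum two (fun i : two => match i with inl _ => T | inr _ => U end).

Definition conat : Type :=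
  {u : nat -> bool & forall i, Bool.le (u (S i)) (u i)}.

Definition conat_seq (u : conat) : nat -> bool := projT1 u.
Coercion conat_seq : conat >-> Funclass.

Lemma under_decr (n i : nat) : Bool.le (S i <? n) (i <? n).
Proof.
  destruct (S i <? n) eqn:E; cbn; [|exact I].
  apply Nat.ltb_lt in E; apply Nat.ltb_lt; lia.
Qed.

Definition under (n : nat) : conat :=
  existT _ (fun i => i <? n) (under_decr n).

Definition infty : conat := existT _ (fun _ => true) (fun _ => eq_refl).

Lemma conat_eq (u v : conat) : (forall i, u i = v i) -> u = v.
Proof.
  destruct u as [u hu], v as [v hv]; cbn; intros h.
  assert (e : u = v) by (apply functional_extensionality; exact h).
  destruct e; f_equal.
  apply is_prop_forall; intros i; apply le_prop.
Qed.

Lemma conat_set (u v : conat) : is_prop (u = v).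
Proof.
  apply (set_of_reflexive (fun u v : conat => forall i, u i = v i)).
  - intros a b; apply is_prop_forall; intros i; apply bool_set.
  - reflexivity.
  - exact conat_eq.
Qed.

Lemma conat_mono (u : conat) (m n : nat) : m <= n -> u n = true -> u m = true.
Proof.
  intros h; induction h as [|n _ IH]; [auto|].
  intros e; apply IH.
  pose proof (projT2 u n) as l; unfold conat_seq in *.
  rewrite e in l; exact l.
Qed.

Lemma under_true (n i : nat) : under n i = true -> i < n.
Proof. apply Nat.ltb_lt. Qed.

Lemma under_lt (n i : nat) : i < n -> under n i = true.
Proof. apply Nat.ltb_lt. Qed.

Lemma under_inj (m n : nat) : under m = under n -> m = n.
Proof.
  intros e.
  destruct (lt_eq_lt_dec m n) as [[l|h]|l]; [|exact h|]; exfalso;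
    apply under_lt in l; [rewrite <- e in l|rewrite e in l];
    apply under_true in l; lia.
Qed.

Lemma under_embedding : is_embedding under.
Proof.
  intros v [m p] [n q].
  assert (e : m = n) by (apply under_inj; congruence).
  destruct e; f_equal; apply conat_set.
Qed.

Definition conat_lt (u v : conat) : Type :=
  {n : nat & ((u = under n) * (v n = true))%type}.

Lemma conat_lt_prop (u v : conat) : is_prop (conat_lt u v).
Proof.
  intros [m [p a]] [n [q b]].
  assert (e : m = n) by (apply under_inj; congruence).
  destruct e; f_equal; f_equal; [apply conat_set|apply bool_set].
Qed.

Lemma conat_lt_trans (u v w : conat) :
  conat_lt u v -> conat_lt v w -> conat_lt u w.
Proof.
  intros [m [p a]] [n [q b]]; exists m; split; [exact p|].
  rewrite q in a; apply under_true in a.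
  apply (conat_mono w m n); [lia|exact b].
Qed.

Lemma conat_lt_ext (u v : conat) :
  (forall z, conat_lt z u -> conat_lt z v) ->
  (forall z, conat_lt z v -> conat_lt z u) -> u = v.
Proof.
  assert (H : forall u v : conat, (forall z, conat_lt z u -> conat_lt z v) ->
    forall i, u i = true -> v i = true).
  { intros a b h i e.
    destruct (h (under i) (existT _ i (eq_refl, e))) as [n [p q]].
    apply under_inj in p; rewrite p; exact q. }
  intros h k; apply conat_eq; intros i.
  apply eq_true_iff_eq; split; apply H; assumption.
Qed.

Lemma conat_lt_wf (u : conat) : acc conat_lt u.
Proof.
  assert (Hn : forall n k, k < n -> acc conat_lt (under k)).
  { induction n as [|n IH]; intros k hk; [lia|].
    constructor; intros v [m [p q]]; rewrite p.
    apply under_true in q; apply IH; lia. }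
  constructor; intros v [m [p _]]; rewrite p; apply (Hn (S m)); lia.
Qed.

Lemma conat_lt_top (u : conat) : notT (conat_lt infty u).
Proof.
  intros [n [p _]].
  assert (h : under n n = true) by (rewrite <- p; reflexivity).
  apply under_true in h; lia.
Qed.

Definition conat_ord : topped_ordinal :=
  {| tord := {| carrier := conat;
                olt := conat_lt;
                olt_prop := conat_lt_prop;
                olt_trans := conat_lt_trans;
                olt_ext := conat_lt_ext;
                olt_wf := conat_lt_wf |};
     top := infty;
     top_max := conat_lt_top |}.

Lemma inl_embedding : is_embedding (@inl nat unit).
Proof.
  intros [n|t] [a p] [b q]; [|discriminate].
  assert (e : a = b) by congruence.
  destruct e; f_equal.
  apply UIP_dec; repeat decide equality.
Qed.

Definition ext_carrier {X K : Type} (j : X -> K) (A : X -> topped_ordinal)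
  (k : K) : Type := forall p : fiber j k, A (projT1 p).

Definition ext_lt {X K : Type} (j : X -> K) (A : X -> topped_ordinal) (k : K)
  (u v : ext_carrier j A k) : Type := {p : fiber j k & olt (u p) (v p)}.

Section Extension.
Context {X K : Type} (j : X -> K) (je : is_embedding j)
  (A : X -> topped_ordinal) (k : K).

Lemma ext_lt_prop (u v : ext_carrier j A k) : is_prop (ext_lt j A k u v).
Proof.
  apply is_prop_sigma; [apply je|intros p; apply olt_prop].
Qed.

Lemma ext_lt_trans (u v w : ext_carrier j A k) :
  ext_lt j A k u v -> ext_lt j A k v w -> ext_lt j A k u w.
Proof.
  intros [p h] [q l]; destruct (je k p q); exists p.
  exact (olt_trans _ _ _ _ h l).
Qed.

Lemma ext_lt_le (u v : ext_carrier j A k) :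
  (forall w, ext_lt j A k w u -> ext_lt j A k w v) ->
  forall (p : fiber j k) (a : A (projT1 p)), olt a (u p) -> olt a (v p).
Proof.
  intros h p a l.
  assert (w : {w : ext_carrier j A k & w p = a}).
  { exists (fun q => transport (fun q => carrier (A (projT1 q)))
                       (eq_trans (eq_sym (je k p p)) (je k p q)) a).
    rewrite eq_trans_sym_inv_l; reflexivity. }
  destruct w as [w e]; rewrite <- e in l |- *.
  destruct (h w (existT _ p l)) as [q m].
  destruct (je k q p); exact m.
Qed.

Lemma ext_lt_ext (u v : ext_carrier j A k) :
  (forall w, ext_lt j A k w u -> ext_lt j A k w v) ->
  (forall w, ext_lt j A k w v -> ext_lt j A k w u) -> u = v.
Proof.
  intros h l; apply functional_extensionality_dep; intros p.
  apply olt_ext; apply ext_lt_le; assumption.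
Qed.

Lemma ext_lt_wf (u : ext_carrier j A k) : acc (ext_lt j A k) u.
Proof.
  assert (H : forall (p : fiber j k) (a : A (projT1 p)), acc olt a ->
    forall u : ext_carrier j A k, u p = a -> acc (ext_lt j A k) u).
  { intros p a Ha; induction Ha as [a _ IH]; intros v e.
    constructor; intros w [q h]; destruct (je k p q).
    rewrite e in h; exact (IH (w p) h w eq_refl). }
  constructor; intros v [p _]; exact (H p (v p) (olt_wf _ _) v eq_refl).
Qed.

Lemma ext_lt_top (u : ext_carrier j A k) :
  notT (ext_lt j A k (fun p => top) u).
Proof. intros [p h]; exact (top_max _ _ h). Qed.

Definition extension : topped_ordinal :=
  {| tord := {| carrier := ext_carrier j A k;
                olt := ext_lt j A k;
                olt_prop := ext_lt_prop;
                olt_trans := ext_lt_trans;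
                olt_ext := ext_lt_ext;
                olt_wf := ext_lt_wf |};
     top := fun p => top;
     top_max := ext_lt_top |}.

End Extension.

Inductive brouwer : Type :=
  | BZ : brouwer
  | BS : brouwer -> brouwer
  | BL : (nat -> brouwer) -> brouwer.

Fixpoint interp_lower (b : brouwer) : topped_ordinal :=
  match b with
  | BZ => one
  | BS b => topped_plus (interp_lower b) one
  | BL b => topped_sum omega1
              (extension (@inl nat unit) inl_embedding
                 (fun n => interp_lower (b n)))
  end.

Fixpoint interp_upper (b : brouwer) : topped_ordinal :=
  match b with
  | BZ => one
  | BS b => topped_plus (interp_upper b) one
  | BL b => topped_sum conat_ord
              (extension under under_embedding
                 (fun n => interp_upper (b n)))
  end.

(* Main.v *)
Require Import Defs.
From Stdlib Require Import CRelationClasses.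
From Stdlib Require Import Bool FunctionalExtensionality.

(** Both parts that produce an omniscience principle use the code
    [BL (fun _ => BZ)], whose members are all [one].  Every function into [one]
    is trivial, so the type underlying its lower interpretation is equivalent to
    [nat + unit], and that of its upper interpretation to [conat].  Compactness of
    [nat + unit] restricts to compactness of [nat], which is [LPO].
    Discreteness of [conat] decides whether a conatural equals [infty], and
    every [p : nat -> bool] gives a conatural, [prefix_conat p], that is
    [infty] exactly when [p] is constantly [true]; this is [WLPO].

    In the other direction [LPO] says that [nat] is compact, hence so is
    [nat + unit], and compactness then propagates along codes because compact
    types are closed under dependent sums ([compact_sigma]) and under the
    extension operation at points with a decidable fiber
    ([compact_extension]).  The embedding [inl : nat -> nat + unit], along which
    the lower interpretation extends, has decidable fibers. *)

(** * Closure properties of compact types *)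

Lemma compact_unit : compact unit.
Proof.
  intros p; destruct (p tt) eqn:E.
  - right; intros [[] e]; congruence.
  - left; exists tt; exact E.
Qed.

Lemma compact_plus (X Y : Type) : compact X -> compact Y -> compact (X + Y).
Proof.
  intros HX HY p.
  destruct (HX (fun x => p (inl x))) as [[x e]|nx]; [left; exists (inl x); exact e|].
  destruct (HY (fun y => p (inr y))) as [[y e]|ny]; [left; exists (inr y); exact e|].
  right; intros [[x|y] e]; [apply nx; exists x|apply ny; exists y]; exact e.
Qed.

Lemma compact_retract (X Y : Type) (f : X -> Y) (g : Y -> X) :
  (forall y, f (g y) = y) -> compact X -> compact Y.
Proof.
  intros H HX p.
  destruct (HX (fun x => p (f x))) as [[x e]|n].
  - left; exists (f x); exact e.
  - right; intros [y e]; apply n; exists (g y); rewrite H; exact e.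
Qed.

(** Compactness of each fiber decides, for every [x], whether [p] has a root
    above [x]; the decision is a boolean function of [x], to which compactness
    of the base applies. *)
Lemma compact_sigma (X : Type) (Y : X -> Type) :
  compact X -> (forall x, compact (Y x)) -> compact {x : X & Y x}.
Proof.
  intros HX HY p.
  pose (d := fun x => HY x (fun y => p (existT Y x y))).
  destruct (HX (fun x => if d x then false else true)) as [[x e]|n].
  - left; destruct (d x) as [[y r]|_]; [|discriminate].
    exists (existT Y x y); exact r.
  - right; intros [[x y] e]; apply n; exists x.
    destruct (d x) as [_|m]; [reflexivity|].
    exfalso; apply m; exists y; exact e.
Qed.

(** The fibers of an embedding are propositions.  A product over an inhabited
    proposition is equivalent to any one of its factors, and a product over an
    empty one is a point, so deciding the fiber reduces the extension to a type
    already known to be compact. *)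
Lemma compact_extension (X K : Type) (j : X -> K) (je : is_embedding j)
  (A : X -> topped_ordinal) (k : K) :
  decidable (fiber j k) -> (forall x, compact (A x)) ->
  compact (ext_carrier j A k).
Proof.
  intros [p|np] HA.
  - apply (compact_retract (A (projT1 p)) _
      (fun a q => transport (fun q => carrier (A (projT1 q))) (je k p q) a)
      (fun h => h p)); [|apply HA].
    intros h; apply functional_extensionality_dep; intros q.
    destruct (je k p q); reflexivity.
  - apply (compact_retract unit _
      (fun _ q => match np q with end) (fun _ => tt)); [|exact compact_unit].
    intros h; apply functional_extensionality_dep; intros q; destruct (np q).
Qed.

(** * Compactness of the lower interpretation *)

Lemma fiber_inl_decidable (X Y : Type) (z : X + Y) :
  decidable (fiber (@inl X Y) z).
Proof.
  destruct z as [x|y].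
  - left; exists x; reflexivity.
  - right; intros [x e]; discriminate.
Qed.

Lemma LPO_compact_interp_lower :
  LPO -> forall b : brouwer, compact (interp_lower b).
Proof.
  intros lpo b; induction b as [|b IH|b IH]; cbn.
  - exact compact_unit.
  - apply compact_sigma; [apply compact_plus; exact compact_unit|].
    intros [u|u]; [exact IH|exact compact_unit].
  - apply compact_sigma; [apply compact_plus; [exact lpo|exact compact_unit]|].
    intros k; apply compact_extension.
    + exact inl_embedding.
    + apply fiber_inl_decidable.
    + exact IH.
Qed.

Lemma compact_interp_lower_LPO :
  (forall b : brouwer, compact (interp_lower b)) -> LPO.
Proof.
  intros H p.
  (* The value [true] at the top point keeps it from being a root. *)
  destruct (H (BL (fun _ => BZ))
    (fun s => match projT1 s with inl n => p n | inr _ => true end))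
    as [[[[n|t] f] e]|m]; cbn in *.
  - left; exists n; exact e.
  - discriminate.
  - right; intros [n e]; apply m.
    exists (existT _ (inl n) (fun _ => tt)); exact e.
Qed.

(** * Discreteness of the upper interpretation *)

Fixpoint all_upto (p : nat -> bool) (n : nat) : bool :=
  match n with
  | 0 => p 0
  | S m => p (S m) && all_upto p m
  end.

Lemma all_upto_decr (p : nat -> bool) (i : nat) :
  Bool.le (all_upto p (S i)) (all_upto p i).
Proof. cbn; destruct (p (S i)), (all_upto p i); cbn; auto. Qed.

Definition prefix_conat (p : nat -> bool) : conat :=
  existT _ (all_upto p) (all_upto_decr p).

Lemma prefix_conat_infty (p : nat -> bool) :
  (forall n, p n = true) -> prefix_conat p = infty.
Proof.
  intros h; apply conat_eq; intros i; cbn.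
  induction i as [|i IH]; cbn; rewrite h; [reflexivity|exact IH].
Qed.

Lemma infty_prefix_conat (p : nat -> bool) :
  prefix_conat p = infty -> forall n, p n = true.
Proof.
  intros e n.
  assert (h : all_upto p n = true).
  { change (prefix_conat p n = true); rewrite e; reflexivity. }
  destruct n as [|n]; [exact h|].
  apply andb_prop in h; apply h.
Qed.

Lemma discrete_interp_upper_WLPO :
  (forall b : brouwer, discrete (interp_upper b)) -> WLPO.
Proof.
  intros H p.
  pose (pt := fun u : conat =>
    existT (ext_carrier under (fun _ : nat => one)) u (fun _ => tt)).
  destruct (H (BL (fun _ => BZ)) (pt (prefix_conat p)) (pt infty)) as [e|n].
  - left; apply infty_prefix_conat; exact (f_equal (@projT1 _ _) e).
  - right; intros h; apply n; exact (f_equal pt (prefix_conat_infty p h)).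
Qed.

Theorem proposition6p21 :
  (iffT (forall b : brouwer, compact (interp_lower b)) LPO *
   ((forall b : brouwer, discrete (interp_upper b)) -> WLPO))%type.
Proof.
  split.
  - split; [exact compact_interp_lower_LPO|exact LPO_compact_interp_lower].
  - exact discrete_interp_upper_WLPO.
Qed.
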